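(* Let $3\le p<q$ be relatively prime integers, let $n\ge 3$, and let $x,y$ be positive integers with $(n-2)x\le q/2$ and $(n-2)y\le p/2$. For $1\le i\le n-2$ put $h_i=pq-ix\,p-(n-1-i)y\,q$, and let $H=\langle p,q,h_1,\dots,h_{n-2}\rangle$ (so $H\in KW_D(p,q)$). Then the defining ideal $I_H\subset \Bbbk[u,v,u_1,\dots,u_{n-2}]$ of $H$ is generated by the $2\times 2$ minors of the $2\times n$ matrix $$A=\begin{bmatrix} u_{n-2} & u^x & v^{p-(n-1)y} & u_1 & u_2 & \cdots & u_{n-4} & u_{n-3}\\ u^{q-(n-1)x} & v^y & u_1 & u_2 & u_3 & \cdots & u_{n-3} & u_{n-2}\end{bmatrix}.$$
   Context: $\langle a_1,\dots,a_k\rangle$ denotes the additive submonoid of $\mathbb{N}$ (with $0$) generated by $a_1,\dots,a_k$. $KW_D(p,q)$ is the class of all semigroups $\langle p,q,h_1,\dots,h_{n-2}\rangle$ with $h_i$ as in the claim, for some $n\ge 3$ and positive integers $x,y$ with $(n-2)x\le q/2$, $(n-2)y\le p/2$. Fix a field $\Bbbk$. The defining ideal $I_H$ is the kernel of the $\Bbbk$-algebra homomorphism $\phi_H:\Bbbk[u,v,u_1,\dots,u_{n-2}]\to \Bbbk[t]$, $u\mapsto t^p$, $v\mapsto t^q$, $u_i\mapsto t^{h_i}$ for $1\le i\le n-2$. The matrix $A$ has the following $n$ columns (top entry, bottom entry): first $(u_{n-2},\,u^{q-(n-1)x})$, second $(u^x,\,v^y)$, third $(v^{p-(n-1)y},\,u_1)$,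 and then $(u_i,\,u_{i+1})$ for $i=1,\dots,n-3$ (no such columns if $n=3$). *)

(* Defs.v *)
From HB Require Import structures.
From mathcomp Require Import all_boot all_order all_algebra.
From mathcomp Require Import mpoly.

Set Implicit Arguments.
Unset Strict Implicit.
Unset Printing Implicit Defensive.

Import GRing.Theory.
Local Open Scope ring_scope.

Definition nsemigroup (m : nat) (a : 'I_m -> nat) : nat -> Prop :=
  fun s => exists c : 'I_m -> nat, s = (\sum_(i < m) c i * a i)%N.

Definition ideal_generated (R : comPzRingType) (G : R -> Prop) : R -> Prop :=
  fun f => exists s : seq (R * R),
    (forall c, c \in s -> G c.2) /\ f = \sum_(c <- s) c.1 * c.2.

Definition phi (K : fieldType) (m : nat) (a : 'I_m -> nat)
    (f : {mpoly K[m]}) : {poly K} :=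
  mmap polyC (fun i : 'I_m => 'X^(a i)) f.

Definition defining_ideal (K : fieldType) (m : nat) (a : 'I_m -> nat) :
    {mpoly K[m]} -> Prop :=
  fun f => phi a f = 0.

(* Under the bounds of KW_params the truncated subtractions below (and the   *)
(* exponents q - (n-1)x, p - (n-1)y) agree with those of the integers:       *)
(* n - 1 <= 2(n - 2) for n >= 3, so (n-1)x <= q, (n-1)y <= p and             *)
(* i x p + (n-1-i) y q <= pq.                                                *)
Definition KW_h (p q n x y i : nat) : nat :=
  (p * q - i * x * p - (n - 1 - i) * y * q)%N.

(* (n-2)x <= q/2 and (n-2)y <= p/2, with denominators cleared. *)
Definition KW_params (p q n x y : nat) : Prop :=
  [/\ (3 <= n)%N, (0 < x)%N, (0 < y)%N,
      (2 * ((n - 2) * x) <= q)%N & (2 * ((n - 2) * y) <= p)%N].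

(* The n generators p, q, h_1, ..., h_(n-2); since n >= 3, n.-2.+2 = n. *)
Definition KW_gen (p q n x y : nat) (i : 'I_n.-2.+2) : nat :=
  match val i with
  | 0 => p
  | 1 => q
  | j.+2 => KW_h p q n x y j.+1
  end.

Definition KW_D (p q : nat) (H : nat -> Prop) : Prop :=
  exists n x y : nat, KW_params p q n x y /\
    forall s, H s <-> nsemigroup (@KW_gen p q n x y) s.

(* The indeterminates u, v, u_1, ..., u_(n-2) have indices 0, 1, ..., n-1. *)
Definition var_u (K : fieldType) (n : nat) : {mpoly K[n.-2.+2]} := 'X_ord0.
Definition var_v (K : fieldType) (n : nat) : {mpoly K[n.-2.+2]} := 'X_(inord 1).
Definition var_ui (K : fieldType) (n i : nat) : {mpoly K[n.-2.+2]} :=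
  'X_(inord i.+1).

Definition KW_top (K : fieldType) (p n x y j : nat) : {mpoly K[n.-2.+2]} :=
  match j with
  | 0 => var_ui K n (n - 2)
  | 1 => var_u K n ^+ x
  | 2 => var_v K n ^+ (p - (n - 1) * y)
  | j'.+3 => var_ui K n j'.+1
  end.

Definition KW_bottom (K : fieldType) (q n x y j : nat) : {mpoly K[n.-2.+2]} :=
  match j with
  | 0 => var_u K n ^+ (q - (n - 1) * x)
  | 1 => var_v K n ^+ y
  | 2 => var_ui K n 1
  | j'.+3 => var_ui K n j'.+2
  end.

Definition KW_matrix (K : fieldType) (p q n x y : nat) :
    'M[{mpoly K[n.-2.+2]}]_(2, n) :=
  \matrix_(i < 2, j < n)
    if i == 0 then KW_top K p n x y j else KW_bottom K q n x y j.

Definition is_minor2 (R : comPzRingType) (n : nat) (A : 'M[R]_(2, n)) :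
    R -> Prop :=
  fun g => exists j1 j2 : 'I_n, (j1 < j2)%N /\
    g = \det (colsub (fun k : 'I_2 => if k == 0 then j1 else j2) A).

(* Main.v *)
(** Put N = n - 1, u_0 = v^(p-Ny) and u_N = u^(q-Nx).  Up to the order of the
columns, A then has the columns (u^x, v^y) and (u_i, u_(i+1)) for i < N, and the
top and bottom degrees of every column differ by xp - yq, so the minors lie in
the kernel.  Conversely, modulo the minors u_i u_j depends only on i + j, hence
it becomes u_0 u_(i+j) or u_N u_(i+j-N), and u^(kx) u_(i+k) becomes
v^(ky) u_i; in particular v^p becomes u^q.  So every monomial is congruent to
u^a v^b with b < p, or to u^a v^b u_i with 0 < i < N, a < x and b < (N-i)y.
The latter has degree pq - Ap - Bq with A = ix - a and B = (N-i)y - b, where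
0 < B < p and (i-1)x < A <= ix.  As p and q are coprime, such a degree is not in
<p, q> and determines (A, B), hence (a, b, i).  Thus monomials of equal degree
are congruent, which is exactly what is needed for the kernel of phi. *)

Require Import Defs.
From mathcomp Require Import all_boot all_order all_algebra.
From mathcomp Require Import mpoly.
From Stdlib Require Import Setoid Morphisms.
From mathcomp Require Import zify ring.

Set Implicit Arguments.
Unset Strict Implicit.
Unset Printing Implicit Defensive.

Import GRing.Theory.
Local Open Scope ring_scope.

(** * Congruence modulo a generated ideal, set up for rewriting *)

Section IdealCongruence.
Variables (R : comPzRingType) (G : R -> Prop).
Implicit Types f g h : R.

Lemma ideal_generated0 : ideal_generated G 0.
Proof. by exists [::]; rewrite big_nil. Qed.

Lemma ideal_generatedD f g :
  ideal_generated G f -> ideal_generated G g -> ideal_generated G (f + g).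
Proof.
move=> [s [Gs ->]] [t [Gt ->]]; exists (s ++ t); rewrite big_cat; split=> // c.
by rewrite mem_cat => /orP[/Gs|/Gt].
Qed.

Lemma ideal_generatedM f g : ideal_generated G g -> ideal_generated G (f * g).
Proof.
move=> [s [Gs ->]]; exists [seq (f * c.1, c.2) | c <- s]; split.
  by move=> c /mapP[d /Gs Gd ->].
by rewrite big_map mulr_sumr; apply: eq_bigr => c _; rewrite mulrA.
Qed.

Lemma mem_ideal_generated f : G f -> ideal_generated G f.
Proof.
move=> Gf; exists [:: (1, f)]; split; last by rewrite big_seq1 mul1r.
by move=> c; rewrite inE => /eqP ->.
Qed.

Lemma ideal_generated_sum (I : eqType) (s : seq I) (F : I -> R) :
  (forall i, i \in s -> ideal_generated G (F i)) ->
  ideal_generated G (\sum_(i <- s) F i).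
Proof.
move=> GF; rewrite big_seq; apply: big_ind => //.
  exact: ideal_generated0.
exact: ideal_generatedD.
Qed.

Definition ideal_cong f g := ideal_generated G (f - g).

#[global] Instance ideal_cong_equiv : Equivalence ideal_cong.
Proof.
split; rewrite /ideal_cong.
- by move=> f; rewrite subrr; apply: ideal_generated0.
- by move=> f g /(ideal_generatedM (-1)); rewrite mulN1r opprB.
- move=> f g h fg gh; have -> : f - h = (f - g) + (g - h) by ring.
  exact: ideal_generatedD.
Qed.

#[global] Instance ideal_cong_mul :
  Proper (ideal_cong ==> ideal_cong ==> ideal_cong) (@GRing.mul R).
Proof.
move=> f f' ff' g g' gg'; rewrite /ideal_cong.
have -> : f * g - f' * g' = g * (f - f') + f' * (g - g') by ring.
by apply: ideal_generatedD; apply: ideal_generatedM.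
Qed.

Lemma ideal_cong_refl f : ideal_cong f f.
Proof. reflexivity. Qed.
#[local] Hint Resolve ideal_cong_refl : core.

Lemma eq_ideal_cong f g : f = g -> ideal_cong f g.
Proof. by move=> ->. Qed.

Lemma ideal_cong_exp k f g : ideal_cong f g -> ideal_cong (f ^+ k) (g ^+ k).
Proof.
move=> fg; elim: k => [|k IH]; first by rewrite !expr0.
by rewrite !exprS IH fg.
Qed.

End IdealCongruence.

#[local] Hint Resolve ideal_cong_refl : core.

(** * Reduction of monomials to normal form by the minor relations *)

Section Reduction.
Variables (R : comPzRingType) (G : R -> Prop).
(** Later [N] is n-1, and [P] and [Q] are the corner exponents of the matrix, so that [N * y + P] is
    p and [N * x + Q] is q. *)
Variables (N x y P Q : nat) (U V : R) (w : nat -> R).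
Hypotheses (w0 : w 0 = V ^+ P) (wN : w N = U ^+ Q).
Hypothesis w_minor : forall i j, (i < N)%N -> (j < N)%N ->
  ideal_cong G (w i * w j.+1) (w j * w i.+1).
Hypothesis uv_minor : forall i, (i < N)%N ->
  ideal_cong G (U ^+ x * w i.+1) (V ^+ y * w i).

Local Notation "f ~~ g" := (ideal_cong G f g) (at level 70).

(** Each minor moves one unit from one index to the other, keeping their sum. *)
Lemma mul_w_shift i j k : (k <= i)%N -> (i <= N)%N -> (j + k <= N)%N ->
  w i * w j ~~ w (i - k) * w (j + k).
Proof.
elim: k => [|k IH] ki iN jN; first by rewrite subn0 addn0.
rewrite IH; [|lia..].
have -> : (i - k = (i - k.+1).+1)%N by lia.
rewrite addnS mulrC; apply: w_minor; lia.
Qed.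

Lemma uv_shift i k : (i + k <= N)%N ->
  U ^+ (k * x) * w (i + k) ~~ V ^+ (k * y) * w i.
Proof.
elim: k => [|k IH] ik; first by rewrite addn0.
rewrite !mulSn !exprD addnS -mulrA mulrCA uv_minor; last by lia.
by rewrite mulrCA IH ?mulrA //; lia.
Qed.

(** This class contains 1 and is closed under multiplication by every variable, hence contains all
    monomials. *)
Definition almost_linear f := (exists a b, f ~~ U ^+ a * V ^+ b) \/
  (exists a b i, (0 < i < N)%N /\ f ~~ U ^+ a * V ^+ b * w i).

Lemma almost_linear_cong f g : f ~~ g -> almost_linear g -> almost_linear f.
Proof.
move=> fg [[a [b E]]|[a [b [i [iN E]]]]]; [left|right].
  by exists a, b; rewrite fg.
by exists a, b, i; rewrite fg.
Qed.

Lemma almost_linearMUV a b f : almost_linear f ->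
  almost_linear (U ^+ a * V ^+ b * f).
Proof.
move=> [[c [d E]]|[c [d [i [iN E]]]]]; [left|right].
  by exists (a + c)%N, (b + d)%N; rewrite E mulrACA -!exprD.
exists (a + c)%N, (b + d)%N, i; split=> //.
by rewrite E mulrA [X in X * w i]mulrACA -!exprD.
Qed.

Lemma almost_linearMU f : almost_linear f -> almost_linear (U * f).
Proof. by move/(almost_linearMUV 1 0); rewrite mulr1. Qed.

Lemma almost_linearMV f : almost_linear f -> almost_linear (V * f).
Proof. by move/(almost_linearMUV 0 1); rewrite mul1r. Qed.

Lemma almost_linear1 : almost_linear 1.
Proof. by left; exists 0, 0; rewrite mulr1. Qed.

Lemma almost_linear_w i : (i <= N)%N -> almost_linear (w i).
Proof.
move=> iN; case: (posnP i) => [->|i0].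
  by left; exists 0, P; rewrite w0 mul1r.
case: (ltngtP i N) iN => // [iN _|-> _].
  by right; exists 0, 0, i; rewrite i0 iN !mul1r.
by left; exists Q, 0; rewrite wN mulr1.
Qed.

(** Shifting pushes one index to an end: to 0 if [i + j <= N], to [N] otherwise. That factor is then
    a power of [V] or [U], leaving a single [w]. *)
Lemma almost_linear_ww i j : (i <= N)%N -> (j <= N)%N ->
  almost_linear (w i * w j).
Proof.
move=> iN jN; case: (leqP (i + j) N) => [ijN|Nij].
  have E : w i * w j ~~ w (i - i) * w (j + i) by apply: mul_w_shift; lia.
  apply: (almost_linear_cong E); rewrite subnn w0.
  have -> : V ^+ P = U ^+ 0 * V ^+ P by rewrite mul1r.
  by apply: almost_linearMUV; apply: almost_linear_w; lia.
have E : w i * w j ~~ w (i - (N - j)) * w (j + (N - j)).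
  by apply: mul_w_shift; lia.
apply: (almost_linear_cong E); rewrite subnKC // wN mulrC.
have -> : U ^+ Q = U ^+ Q * V ^+ 0 by rewrite mulr1.
by apply: almost_linearMUV; apply: almost_linear_w; lia.
Qed.

Lemma almost_linearMw j f : (j <= N)%N -> almost_linear f ->
  almost_linear (w j * f).
Proof.
move=> jN [[a [b E]]|[a [b [i [iN E]]]]].
  apply: (@almost_linear_cong _ (U ^+ a * V ^+ b * w j)).
    by rewrite E mulrC.
  by apply: almost_linearMUV; apply: almost_linear_w.
apply: (@almost_linear_cong _ (U ^+ a * V ^+ b * (w j * w i))).
  by rewrite E mulrCA.
by apply: almost_linearMUV; apply: almost_linear_ww; lia.
Qed.

Hypothesis x_gt0 : (0 < x)%N.

Hypothesis VP_gt0 : (0 < N * y + P)%N.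

(** Running [uv_shift] from index 0 to [N] gives the relation between v^p and u^q; Euclidean
    division of [b] by p then bounds the exponent of [V]. *)
Lemma cong_pure a b : exists a' b', (b' < N * y + P)%N /\
  U ^+ a * V ^+ b ~~ U ^+ a' * V ^+ b'.
Proof.
have E : V ^+ (N * y + P) ~~ U ^+ (N * x + Q).
  by have := @uv_shift 0 N (leqnn N); rewrite !exprD -w0 -wN => ->.
exists (a + (N * x + Q) * (b %/ (N * y + P)))%N, (b %% (N * y + P))%N.
split; first by rewrite ltn_mod.
rewrite {1}(divn_eq b (N * y + P)) [(b %/ _ * _)%N]mulnC.
rewrite !exprD [V ^+ (_ * _)]exprM [U ^+ (_ * _)]exprM.
by rewrite (ideal_cong_exp _ E) mulrA.
Qed.

(** The bounds on the exponents are chosen so that distinct normal forms have distinct degrees. *)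
Definition normal_form f :=
  (exists a b, (b < N * y + P)%N /\ f ~~ U ^+ a * V ^+ b) \/
  (exists a b i, [/\ (0 < i < N)%N, (a < x)%N, (b < (N - i) * y)%N
                   & f ~~ U ^+ a * V ^+ b * w i]).

Lemma normal_form_pure f a b : f ~~ U ^+ a * V ^+ b -> normal_form f.
Proof.
move=> E; left; have [a' [b' [ltb E']]] := cong_pure a b.
by exists a', b'; rewrite E E'.
Qed.

(** If [b] is too large, [uv_shift] read backwards trades [V ^+ ((N - i) * y)] for a power of [U]
    while raising the index to [N], where [w] is itself a power of [U]. *)
Lemma normal_form_mixed f a b i : (i <= N)%N -> (a < x)%N ->
  f ~~ U ^+ a * V ^+ b * w i -> normal_form f.
Proof.
move=> iN ax E.
case: (posnP i) => [i0|i_gt0].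
  apply: (@normal_form_pure _ a (b + P)).
  by rewrite E i0 w0 exprD mulrA.
case: (ltnP b ((N - i) * y)) => [bN|Nb].
  right; exists a, b, i; split=> //; rewrite i_gt0 /= ltn_neqAle iN andbT.
  by apply/eqP=> iN'; rewrite iN' subnn in bN.
apply: (@normal_form_pure _ (a + (N - i) * x + Q) (b - (N - i) * y)).
have /uv_shift EN : (i + (N - i) <= N)%N by lia.
rewrite E -(subnK Nb) [V ^+ _]exprD -!mulrA -EN subnKC // wN.
by rewrite !exprD addnK -!mulrA; apply: eq_ideal_cong; ring.
Qed.

(** Each trade of [U ^+ x] for [V ^+ y] lowers the index by one. Either the index reaches 0 and the
    result is pure, or after [a %/ x] trades the exponent of [U] is below [x]. *)
Lemma almost_linear_normal_form f : almost_linear f -> normal_form f.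
Proof.
move=> [[a [b E]]|[a [b [i [/andP[i0 iN] E]]]]].
  exact: normal_form_pure E.
have Hw k : (k <= i)%N -> U ^+ (k * x) * w i ~~ V ^+ (k * y) * w (i - k).
  by move=> ki; rewrite -{1}(subnK ki) uv_shift //; lia.
case: (leqP i (a %/ x)) => [ia|ai].
  have le_a : (i * x <= a)%N by rewrite -leq_divRL.
  apply: (@normal_form_pure _ (a - i * x) (b + i * y + P)).
  rewrite E -(subnK le_a) exprD addnK -!mulrA [V ^+ b * w i]mulrC.
  rewrite [U ^+ (i * x) * _]mulrA Hw // subnn w0.
  by rewrite !exprD; apply: eq_ideal_cong; ring.
apply: (@normal_form_mixed _ (a %% x) (b + a %/ x * y) (i - a %/ x)).
- exact: leq_trans (leq_subr _ _) (ltnW iN).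
- by rewrite ltn_mod.
rewrite E {1}(divn_eq a x) addnC exprD -!mulrA [V ^+ b * w i]mulrC.
rewrite [U ^+ (_ * x) * _]mulrA Hw ?(ltnW ai) //.
by rewrite !exprD; apply: eq_ideal_cong; ring.
Qed.

End Reduction.

(** * The map [phi], weighted degrees and a criterion for its kernel *)

Section Phi.
Variables (K : fieldType) (n : nat) (a : 'I_n -> nat).
Implicit Types f g : {mpoly K[n]}.

Lemma phiM f g : phi a (f * g) = phi a f * phi a g.
Proof. by rewrite /phi rmorphM. Qed.

Lemma phiB f g : phi a (f - g) = phi a f - phi a g.
Proof. by rewrite /phi rmorphB. Qed.

Lemma phi_exp f k : phi a (f ^+ k) = phi a f ^+ k.
Proof. by rewrite /phi rmorphXn. Qed.

Lemma phi_var i : phi a 'X_i = 'X^(a i) :> {poly K}.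
Proof. by rewrite /phi mmapX mmap1U. Qed.

Definition wdeg (m : 'X_{1..n}) : nat := (\sum_(i < n) a i * m i)%N.

Lemma phi_monomial m : phi a 'X_[m] = 'X^(wdeg m) :> {poly K}.
Proof.
rewrite /phi mmapX /mmap1 /wdeg.
by elim/big_rec2: _ => // i s t _ ->; rewrite exprD exprM.
Qed.

Lemma phi_coef f d :
  (phi a f)`_d = \sum_(m <- msupp f) f@_m * (d == wdeg m)%:R.
Proof.
rewrite {1}[f]mpolyE /phi raddf_sum coef_sum; apply: eq_bigr => m _ /=.
by rewrite mmapZ coefCM -[mmap _ _ _]/(phi a 'X_[m]) phi_monomial coefXn.
Qed.

Lemma ideal_generated_phi0 (G : {mpoly K[n]} -> Prop) :
  (forall g, G g -> phi a g = 0) ->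
  forall f, ideal_generated G f -> phi a f = 0.
Proof.
move=> G0 _ [s [Gs ->]]; rewrite /phi raddf_sum big_seq big1 // => c cs.
by rewrite /= -[mmap _ _ _]/(phi a (c.1 * c.2)) phiM (G0 c.2 (Gs c cs)) mulr0.
Qed.

(* Each monomial of [f] is replaced by a chosen monomial of [f] of the same
   weight; the coefficients of the result are those of [phi a f]. *)
Lemma phi0_ideal_generated (G : {mpoly K[n]} -> Prop) :
  (forall m1 m2, wdeg m1 = wdeg m2 -> ideal_cong G 'X_[m1] 'X_[m2]) ->
  forall f, phi a f = 0 -> ideal_generated G f.
Proof.
move=> Gcong f f0; set s := msupp f.
(* If no monomial of [s] has weight [d], this is the default monomial 1, which only ever gets
   coefficient 0. *)
pose rep d : {mpoly K[n]} :=
  'X_[nth 0%MM s (find (fun m => wdeg m == d) s)].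
pose D := (\max_(m <- s) wdeg m).+1.
have ltD m : m \in s -> (wdeg m < D)%N by move=> ms; apply: leq_bigmax_seq.
have rep_sum0 : \sum_(m <- s) f@_m *: rep (wdeg m) = 0.
  transitivity (\sum_(d < D) (phi a f)`_d *: rep d); last first.
    by rewrite big1 // => d _; rewrite f0 coef0 scale0r.
  under [RHS]eq_bigr do rewrite phi_coef scaler_suml.
  rewrite exchange_big /= big_seq [RHS]big_seq; apply: eq_bigr => m ms.
  rewrite (bigD1 (Ordinal (ltD m ms))) //= eqxx mulr1 big1 ?addr0 // => d.
  by rewrite -val_eqE /= => /negPf ->; rewrite mulr0 scale0r.
have -> : f = \sum_(m <- s) (f@_m *: 'X_[m] - f@_m *: rep (wdeg m)).
  by rewrite sumrB rep_sum0 subr0 -mpolyE.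
apply: ideal_generated_sum => m ms; rewrite -scalerBr -mul_mpolyC.
apply/ideal_generatedM/Gcong/esym/eqP.
have := @nth_find _ 0%MM (fun m' => wdeg m' == wdeg m) s.
by apply; apply/hasP; exists m.
Qed.

End Phi.

(** * Combinations of two coprime integers *)

Section Arithmetic.
Variables (p q : nat).
Hypothesis hcop : coprime p q.

(** Modulo [p] the factor [q] cancels, so [p] divides the difference of [b] and [b'], which is
    smaller than [p]. *)
Lemma coprime_comb_inj a b a' b' : (b < p)%N -> (b' < p)%N ->
  (a * p + b * q = a' * p + b' * q)%N -> a = a' /\ b = b'.
Proof.
move=> bp b'p E.
have bb' : b = b'.
  have : b * q == b' * q %[mod p] by rewrite -(modnMDl a) E modnMDl.
  case: (leqP b b') => [le_b|/ltnW le_b]; last first.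
    rewrite eqn_mod_dvd ?leq_mul2r ?le_b ?orbT // -mulnBl Gauss_dvdl //.
    by case: (posnP (b - b')) => [|bb' /(dvdn_leq bb')]; lia.
  rewrite eq_sym eqn_mod_dvd ?leq_mul2r ?le_b ?orbT // -mulnBl Gauss_dvdl //.
  by case: (posnP (b' - b)) => [|bb' /(dvdn_leq bb')]; lia.
split=> //; move: E; rewrite bb' => /addIn /eqP.
by rewrite eqn_pmul2r ?(leq_ltn_trans (leq0n b) bp) // => /eqP.
Qed.

(** Equality would make [p] divide [b], so that [b * q] alone reaches [p * q]. *)
Lemma coprime_comb_neq a b : (0 < p)%N -> (0 < a)%N -> (0 < b)%N ->
  (a * p + b * q)%N <> (p * q)%N.
Proof.
move=> p0 a0 b0 E.
have : (p %| b * q)%N by rewrite -(dvdn_addr _ (dvdn_mull a (dvdnn p))) E dvdn_mulr.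
rewrite Gauss_dvdl // => /(dvdn_leq b0) pb.
have := leq_mul pb (leqnn q); have : (0 < a * p)%N by rewrite muln_gt0 a0.
by lia.
Qed.

End Arithmetic.

(** * The matrix, its minors and their degrees *)

Lemma det_colsub2 (R : comPzRingType) (n : nat) (A : 'M[R]_(2, n)) (j1 j2 : 'I_n) :
  \det (colsub (fun k : 'I_2 => if k == 0 then j1 else j2) A) =
  A 0 j1 * A 1 j2 - A 0 j2 * A 1 j1.
Proof.
rewrite (expand_det_row _ ord0) !big_ord_recl big_ord0 addr0 /cofactor.
rewrite !det_mx11 !mxE /= expr0 expr1 mul1r mulN1r mulrN.
by congr (_ * A _ _ - _ * A _ _); apply: val_inj.
Qed.

Section KunzWaldi.
Variables (K : fieldType) (p q n x y : nat).
Hypotheses (hp : (3 <= p)%N) (hpq : (p < q)%N) (hcop : coprime p q).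
Hypotheses (hn : (3 <= n)%N) (hx : (0 < x)%N) (hy : (0 < y)%N).
Hypotheses (hxq : (2 * ((n - 2) * x) <= q)%N) (hyp : (2 * ((n - 2) * y) <= p)%N).

Local Notation gen := (@KW_gen p q n x y).
Local Notation h := (KW_h p q n x y).
Local Notation U := (var_u K n).
Local Notation V := (var_v K n).
Local Notation Q := (q - (n - 1) * x)%N.
Local Notation P := (p - (n - 1) * y)%N.
Local Notation minors := (is_minor2 (KW_matrix K p q n x y)).
Local Notation top := (KW_top K p n x y).
Local Notation bottom := (KW_bottom K q n x y).

Lemma le_nx_q : ((n - 1) * x <= q)%N.
Proof.
by apply: leq_trans hxq; rewrite mulnA leq_mul2r; apply/orP; right; lia.
Qed.

Lemma le_ny_p : ((n - 1) * y <= p)%N.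
Proof.
by apply: leq_trans hyp; rewrite mulnA leq_mul2r; apply/orP; right; lia.
Qed.

(** No truncation occurs: after multiplying by n-1, the subtracted terms are compared with [p * q]
    split in the proportion i to n-1-i, using (n-1)x <= q and (n-1)y <= p. *)
Lemma KW_hE i : (i <= n - 1)%N ->
  (h i + i * x * p + (n - 1 - i) * y * q)%N = (p * q)%N.
Proof.
move=> iN; have n1 : (0 < n - 1)%N by lia.
suff le : (i * x * p + (n - 1 - i) * y * q <= p * q)%N by rewrite /KW_h; lia.
rewrite -(leq_pmul2l n1).
have -> : ((n - 1) * (p * q) = i * q * p + (n - 1 - i) * p * q)%N.
  by rewrite -{1}(subnKC iN) mulnDl !mulnA -!(mulnAC _ p).
have -> : ((n - 1) * (i * x * p + (n - 1 - i) * y * q) =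
    i * ((n - 1) * x) * p + (n - 1 - i) * ((n - 1) * y) * q)%N.
  by ring.
by rewrite leq_add // leq_mul2r leq_mul2l ?le_nx_q ?le_ny_p !orbT.
Qed.

(* The corner powers of [u] and [v] continue the sequence [u_1, ..., u_(n-2)],
   so that every column but the second has the form [(w i, w i.+1)]. *)
Definition KW_w (i : nat) : {mpoly K[n.-2.+2]} :=
  if i == 0%N then V ^+ P else if i == (n - 1)%N then U ^+ Q else var_ui K n i.

(** The column with entries [KW_w i] and [KW_w i.+1]. The last link of the chain is column 0 of the
    matrix; column 1, with entries u^x and v^y, is skipped. *)
Definition KW_col (i : nat) : nat := if i == (n - 2)%N then 0 else i.+2.

Lemma KW_top_col i : (i < n - 1)%N -> top (KW_col i) = KW_w i.
Proof.
move=> iN; rewrite /KW_col /KW_w; case: eqP => [->|ne].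
  by rewrite !ifN //; lia.
by case: i iN ne => [|i] iN ne //=; rewrite ifN //; lia.
Qed.

Lemma KW_bottom_col i : (i < n - 1)%N -> bottom (KW_col i) = KW_w i.+1.
Proof.
move=> iN; rewrite /KW_col /KW_w; case: eqP => [->|ne] /=.
  by rewrite ifT //; lia.
by case: i iN ne => [|i] iN ne /=; rewrite ifN //; lia.
Qed.

Lemma KW_minor_cong j1 j2 : (j1 < n)%N -> (j2 < n)%N ->
  ideal_cong minors (top j1 * bottom j2) (top j2 * bottom j1).
Proof.
wlog lt12 : j1 j2 / (j1 < j2)%N => [IH l1 l2|l1 l2].
  have [lt|lt|->] := ltngtP j1 j2; first exact: IH.
    by rewrite (IH _ _ lt l2 l1).
  by [].
apply: mem_ideal_generated; exists (Ordinal l1), (Ordinal l2); split=> //.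
by rewrite det_colsub2 !mxE.
Qed.

Lemma phi_u : phi gen U = 'X^p.
Proof. by rewrite phi_var. Qed.

Lemma phi_v : phi gen V = 'X^q.
Proof. by rewrite phi_var /KW_gen /= inordK. Qed.

(** The formula for h also covers the corners: it gives qP at i = 0 and pQ at i = n-1. *)
Lemma phi_w i : (i <= n - 1)%N -> phi gen (KW_w i) = 'X^(h i).
Proof.
move=> iN; rewrite /KW_w; have := le_nx_q; have := le_ny_p => leP leQ.
case: eqP => [->|/eqP i0].
  by rewrite phi_exp phi_v -exprM /KW_h !mul0n !subn0 mulnBr mulnC [(q * _)%N]mulnC.
case: eqP => [->|/eqP i1].
  by rewrite phi_exp phi_u -exprM /KW_h subnn !mul0n !subn0 mulnBr [(p * (_ * x))%N]mulnC.
rewrite /var_ui phi_var /KW_gen /= inordK; last by lia.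
by case: i iN i0 i1.
Qed.

Lemma KW_h_succ i : (i < n - 1)%N -> (h i + y * q = h i.+1 + x * p)%N.
Proof.
move=> iN; have := KW_hE (ltnW iN); have := KW_hE iN.
have -> : (n - 1 - i = (n - 1 - i.+1).+1)%N by lia.
by rewrite !mulSn !mulnDl; lia.
Qed.

(** The last equation says, without subtraction, that the two degrees differ by the same amount in
    every column; hence both products in a minor have equal degree. *)
Lemma phi_column j : (j < n)%N -> exists t b, [/\ phi gen (top j) = 'X^t,
  phi gen (bottom j) = 'X^b & (t + y * q = b + x * p)%N].
Proof.
move=> jn.
have Hw i : (i < n - 1)%N -> KW_col i = j -> exists t b,
    [/\ phi gen (top j) = 'X^t, phi gen (bottom j) = 'X^b
      & (t + y * q = b + x * p)%N].
  move=> iN <-; exists (h i), (h i.+1).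
  rewrite KW_top_col // KW_bottom_col // !phi_w ?(ltnW iN) //.
  by split=> //; apply: KW_h_succ.
case: j jn Hw => [|[|j]] jn Hw.
- by apply: (Hw (n - 2)%N); rewrite /KW_col ?eqxx //; lia.
- exists (x * p)%N, (y * q)%N; rewrite !phi_exp phi_u phi_v -!exprM.
  by rewrite mulnC [(q * y)%N]mulnC addnC.
- by apply: (Hw j); rewrite /KW_col ?ifN //; lia.
Qed.

Lemma phi_minor0 g : minors g -> phi gen g = 0.
Proof.
move=> [j1 [j2 [_ ->]]]; rewrite det_colsub2 !mxE /= phiB !phiM.
have [t1 [b1 [-> -> E1]]] := phi_column (ltn_ord j1).
have [t2 [b2 [-> -> E2]]] := phi_column (ltn_ord j2).
by rewrite -!exprD; apply/eqP; rewrite subr_eq0; apply/eqP; congr 'X^_; lia.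
Qed.

Lemma monomial_normal_form m :
  normal_form minors (n - 1) x y P U V KW_w 'X_[m].
Proof.
have w0 : KW_w 0 = V ^+ P by [].
have wN : KW_w (n - 1) = U ^+ Q by rewrite /KW_w eqxx ifN //; lia.
have ww i j : (i < n - 1)%N -> (j < n - 1)%N ->
    ideal_cong minors (KW_w i * KW_w j.+1) (KW_w j * KW_w i.+1).
  move=> iN jN; rewrite -(KW_top_col iN) -(KW_top_col jN).
  rewrite -(KW_bottom_col iN) -(KW_bottom_col jN).
  by apply: KW_minor_cong; rewrite /KW_col; case: eqP; lia.
have uv i : (i < n - 1)%N ->
    ideal_cong minors (U ^+ x * KW_w i.+1) (V ^+ y * KW_w i).
  move=> iN; rewrite -(KW_top_col iN) -(KW_bottom_col iN) [V ^+ y * _]mulrC.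
  by apply: (@KW_minor_cong 1); rewrite /KW_col; [|case: eqP]; lia.
apply: (almost_linear_normal_form w0 wN uv) => //.
  by rewrite subnKC ?le_ny_p //; lia.
rewrite mpolyXE_id; elim/big_rec: _ => [|i f _ IH].
  exact: almost_linear1.
elim: (m i) => [|k IHk]; first by rewrite mul1r.
rewrite exprS -mulrA; move: (_ * f) IHk => g IHg.
have [i0|i0] := posnP i.
  have -> : i = ord0 by apply: val_inj.
  exact: almost_linearMU.
have [i1|i1] := eqVneq (i : nat) 1%N.
  have -> : i = inord 1 by rewrite -i1 inord_val.
  exact: almost_linearMV.
(* The remaining indices are at least 2, and u_k has index k+1. *)
have -> : 'X_i = KW_w (i - 1) :> {mpoly K[n.-2.+2]}.
  have := ltn_ord i; rewrite /KW_w => lti; rewrite !ifN; try lia.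
  by rewrite /var_ui -subSn // subn1 /= inord_val.
by apply: (almost_linearMw w0 wN ww); have := ltn_ord i => //; lia.
Qed.

(** * Degrees separate the normal forms *)

Lemma phi_cong f g : ideal_cong minors f g -> phi gen f = phi gen g.
Proof.
by move/(ideal_generated_phi0 phi_minor0)/eqP; rewrite phiB subr_eq0 => /eqP.
Qed.

Lemma polyXn_inj : injective (fun d => 'X^d : {poly K}).
Proof. by move=> d e /(congr1 (size \o @polyseq K)); rewrite /= !size_polyXn => -[]. Qed.

Lemma wdeg_pure m a b : ideal_cong minors 'X_[m] (U ^+ a * V ^+ b) ->
  wdeg gen m = (a * p + b * q)%N.
Proof.
move/phi_cong; rewrite phi_monomial phiM !phi_exp phi_u phi_v -!exprM -exprD.
by move/polyXn_inj; rewrite mulnC [(q * b)%N]mulnC.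
Qed.

Lemma wdeg_mixed m a b i : (i <= n - 1)%N ->
  ideal_cong minors 'X_[m] (U ^+ a * V ^+ b * KW_w i) ->
  wdeg gen m = (a * p + b * q + h i)%N.
Proof.
move=> iN /phi_cong; rewrite phi_monomial !phiM !phi_exp phi_u phi_v phi_w //.
by rewrite -!exprM -!exprD => /polyXn_inj; rewrite mulnC [(q * b)%N]mulnC.
Qed.

(** A subtraction-free form of the degree pq - Ap - Bq, with A = ix - a and B = (n-1-i)y - b. *)
Lemma wdeg_mixed_gap a b i : (0 < i < n - 1)%N -> (a < x)%N ->
  (b < (n - 1 - i) * y)%N ->
  (a * p + b * q + h i + ((i * x - a) * p + ((n - 1 - i) * y - b) * q)
   = p * q)%N.
Proof.
move=> /andP[i0 iN] ax bN; rewrite -(KW_hE (ltnW iN)).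
have le_a : (a * p <= i * x * p)%N.
  by rewrite leq_mul2r (leq_trans (ltnW ax)) ?orbT // leq_pmull.
have le_b : (b * q <= (n - 1 - i) * y * q)%N by rewrite leq_mul2r (ltnW bN) orbT.
by rewrite !mulnBl; lia.
Qed.

(** Adding the gap Ap + Bq to a pure degree would write pq as a combination of p and q with positive
    coefficients. *)
Lemma wdeg_pure_neq_mixed a b i c d : (0 < i < n - 1)%N -> (a < x)%N ->
  (b < (n - 1 - i) * y)%N -> (c * p + d * q <> a * p + b * q + h i)%N.
Proof.
move=> iN ax bN E; have := wdeg_mixed_gap iN ax bN; rewrite -E => E'.
have ai : (0 < i * x - a)%N.
  by rewrite subn_gt0 (leq_trans ax) // leq_pmull //; case/andP: iN.
have := @coprime_comb_neq p q hcop
  (c + (i * x - a))%N (d + ((n - 1 - i) * y - b))%N.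
by rewrite !mulnDl; apply; lia.
Qed.

Lemma wdeg_mixed_inj a b i a' b' i' :
  (0 < i < n - 1)%N -> (a < x)%N -> (b < (n - 1 - i) * y)%N ->
  (0 < i' < n - 1)%N -> (a' < x)%N -> (b' < (n - 1 - i') * y)%N ->
  (a * p + b * q + h i = a' * p + b' * q + h i')%N ->
  [/\ a = a', b = b' & i = i'].
Proof.
move=> iN ax bN iN' ax' bN' E.
have := wdeg_mixed_gap iN ax bN; rewrite -(wdeg_mixed_gap iN' ax' bN') E.
(* This puts B below p, as uniqueness of the gap's coefficients requires. *)
have ltp j : (0 < j < n - 1)%N -> ((n - 1 - j) * y < p)%N.
  move=> jN; apply: leq_trans le_ny_p; rewrite ltn_mul2r hy; lia.
move/addnI/(coprime_comb_inj hcop _ _) => [].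
- by rewrite (leq_ltn_trans (leq_subr _ _)) ?ltp.
- by rewrite (leq_ltn_trans (leq_subr _ _)) ?ltp.
move=> Ea Eb.
(* A = ix - a lies above (i-1)x and is at most ix; these intervals are disjoint for distinct i. *)
have ii' : i = i'.
  apply/eqP; rewrite eqn_leq; apply/andP; split; rewrite leqNgt; apply/negP.
    by move=> lt; have := leq_mul lt (leqnn x); rewrite mulSn; lia.
  by move=> lt; have := leq_mul lt (leqnn x); rewrite mulSn; lia.
move: Ea Eb bN'; rewrite -ii' => Ea Eb bN'.
have : (x <= i * x)%N by rewrite leq_pmull //; case/andP: iN.
by split=> //; lia.
Qed.

Lemma wdeg_eq_cong m1 m2 : wdeg gen m1 = wdeg gen m2 ->
  ideal_cong minors 'X_[m1] 'X_[m2].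
Proof.
have Pp : ((n - 1) * y + P = p)%N by rewrite subnKC // le_ny_p.
case: (monomial_normal_form m1) => [[a [b [bp E]]]|[a [b [i [iN ax bN E]]]]];
case: (monomial_normal_form m2) => [[a' [b' [bp' E']]]|[a' [b' [i' [iN' ax' bN' E']]]]].
- rewrite (wdeg_pure E) (wdeg_pure E') => /(coprime_comb_inj hcop _ _) [].
  + by rewrite -Pp.
  + by rewrite -Pp.
  by move=> Ea Eb; rewrite E E' Ea Eb.
- rewrite (wdeg_pure E) (wdeg_mixed _ E'); last by lia.
  by move/(wdeg_pure_neq_mixed iN' ax' bN').
- rewrite (wdeg_pure E') (wdeg_mixed _ E); last by lia.
  by move/esym/(wdeg_pure_neq_mixed iN ax bN).
- rewrite (wdeg_mixed _ E) 1?(wdeg_mixed _ E'); try lia.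
  move/(wdeg_mixed_inj iN ax bN iN' ax' bN') => [Ea Eb Ei].
  by rewrite E E' Ea Eb Ei.
Qed.

End KunzWaldi.

Theorem proposition1p2 (K : fieldType) (p q n x y : nat)
    (hp : (3 <= p)%N) (hpq : (p < q)%N) (hcop : coprime p q)
    (hn : (3 <= n)%N) (hx : (0 < x)%N) (hy : (0 < y)%N)
    (hxq : (2 * ((n - 2) * x) <= q)%N) (hyp : (2 * ((n - 2) * y) <= p)%N) :
  KW_D p q (nsemigroup (@KW_gen p q n x y)) /\
  (forall f : {mpoly K[n.-2.+2]},
     defining_ideal (@KW_gen p q n x y) f <->
     ideal_generated (is_minor2 (KW_matrix K p q n x y)) f).
Proof.
split; first by exists n, x, y.
move=> f; split.
  apply: phi0_ideal_generated => m1 m2.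
  exact: wdeg_eq_cong.
by apply: ideal_generated_phi0 => g; apply: phi_minor0.
Qed.
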